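(* Let $A\in\mathbb{R}^{n\times r}_{\ge 0}$ be an infinitesimally rigid nonnegative rank-$r$ factor (of the symmetric matrix $AA^T$). Then: (i) $A$ has at least $(r^2-r)/2+1$ zero entries; and (ii) for every ordered pair of distinct indices $i,j\in\{1,\dots,r\}$ there is a row of $A$ with a zero in position $i$ and a nonzero entry in position $j$.
   Context: Here $n,r$ are positive integers. A nonnegative rank-$r$ factor is an entrywise nonnegative $n\times r$ matrix $A$ of rank $r$. Let $a_1^T,\dots,a_n^T$ be the rows of $A$. An infinitesimal motion of $A$ is a matrix $\dot A\in\mathbb{R}^{n\times r}$ with rows $\dot a_1^T,\dots,\dot a_n^T$ such that $a_i^T\dot a_j+\dot a_i^Ta_j=0$ for all $(i,j)\in[n]\times[n]$, where $[n]=\{1,\dots,n\}$, and such that for some $\epsilon>0$, $a_i+t\dot a_i\ge 0$ entrywise for all $i$ and all $t\in[0,\epsilon)$. $A$ is infinitesimally rigid if it has no nonzero infinitesimal motions.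
   Formalization: Part (i) is stated only for r ≥ 2, since it fails for r = 1: with n = r = 1 the matrix A = [1] is infinitesimally rigid of rank 1 but has no zero entry, while the claimed bound is 1. *)

(* Defs.v *)
From HB Require Import structures.
From mathcomp Require Import all_boot all_order all_algebra.
From mathcomp Require Import reals.

Set Implicit Arguments.
Unset Strict Implicit.
Unset Printing Implicit Defensive.

Import Order.TTheory GRing.Theory Num.Theory.
Local Open Scope ring_scope.

Definition nonneg_mx (R : realType) (m n : nat) (A : 'M[R]_(m, n)) : Prop :=
  forall i j, 0 <= A i j.

Definition nonneg_rank_factor (R : realType) (n r : nat) (A : 'M[R]_(n, r)) :
    Prop :=
  nonneg_mx A /\ \rank A = r.

(* The library's row vectors play the role of a_i^T, so the scalar products
   a_i^T b_j are the 1 x 1 matrices row i A *m (row j B)^T. *)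
Definition infinitesimal_motion (R : realType) (n r : nat)
    (A dA : 'M[R]_(n, r)) : Prop :=
  (forall i j : 'I_n,
      row i A *m (row j dA)^T + row i dA *m (row j A)^T = 0) /\
  (exists2 eps : R, 0 < eps &
     forall (i : 'I_n) (t : R), 0 <= t < eps ->
       nonneg_mx (row i A + t *: row i dA)).

Definition infinitesimally_rigid (R : realType) (n r : nat)
    (A : 'M[R]_(n, r)) : Prop :=
  forall dA : 'M[R]_(n, r), infinitesimal_motion A dA -> dA = 0.

Definition zero_entries (R : realType) (n r : nat) (A : 'M[R]_(n, r)) :
    {set 'I_n * 'I_r} :=
  [set p | A p.1 p.2 == 0].

(* Main.v *)
Require Import Defs.
From mathcomp Require Import all_boot all_order all_algebra.
From mathcomp Require Import reals.

Set Implicit Arguments.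
Unset Strict Implicit.
Unset Printing Implicit Defensive.

Import Order.TTheory GRing.Theory Num.Theory.
Local Open Scope ring_scope.

(** Every skew-symmetric [D] yields a candidate motion [A *m D], because
    [A (A D)^T + (A D) A^T = A (D^T + D) A^T = 0].  A positive entry of [A]
    stays positive for small times whatever its velocity, so [A *m D] is a
    motion as soon as its entries are nonnegative at the zeros of [A].  As [A]
    has full column rank, [A *m D] vanishes only if [D] does; hence rigidity
    says that no nonzero skew [D] has this sign property
    ([rigid_skew_eq0]).

    Both conclusions follow by exhibiting such a [D].  If every row vanishing
    at [i] also vanished at [j], the generator of the rotations in the
    [(i, j)]-plane would do.  For the count, the entries of [A *m D] at the
    zeros of [A] are linear forms on the space of skew matrices, of dimension
    [r (r - 1) / 2 > 0].  When there are at most that many forms, either they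
    have a common nonzero zero, or they form a basis of the dual space and
    can all be given the value 1 ([exists_nonneg_image]). *)

Section SkewMotions.

Variables (R : realType) (n r : nat).
Implicit Types (A dA : 'M[R]_(n, r)) (D : 'M[R]_r).

(** Finitely many positive entries leave a common positive time before any of
    them can reach 0: the entry [a] moving at speed [v] is safe up to time
    [a / (1 + |v|)]. *)
Lemma nonneg_for_small_time A dA :
  nonneg_mx A -> (forall k l, A k l = 0 -> 0 <= dA k l) ->
  exists2 eps : R, 0 < eps &
    forall (k : 'I_n) (t : R), 0 <= t < eps ->
      nonneg_mx (row k A + t *: row k dA).
Proof.
move=> A_ge0 dA_ge0.
pose safe (p : 'I_n * 'I_r) :=
  if A p.1 p.2 == 0 then 1 else A p.1 p.2 / (1 + `|dA p.1 p.2|).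
have den_gt0 (x : R) : 0 < 1 + `|x| by rewrite ltr_pwDl.
exists (\big[Num.min/1]_p safe p).
  apply: lt_bigmin => // p _; rewrite /safe; case: eqP => // /eqP A_neq0.
  by rewrite divr_gt0 // lt_neqAle eq_sym A_neq0 A_ge0.
move=> k t /andP[t_ge0 t_lt] i l; rewrite !mxE.
have: t < safe (k, l) by apply: lt_le_trans t_lt _; apply: bigmin_le_cond.
rewrite /safe /=; case: eqP => [A0 _|_].
  by rewrite A0 add0r mulr_ge0 // dA_ge0.
rewrite ltr_pdivlMr // mulrDr mulr1 => t_small.
rewrite -[t * dA k l]opprK subr_ge0 -mulrN.
apply: le_trans (ltW t_small); apply: ler_wpDl => //.
by rewrite ler_wpM2l // -normrN ler_norm.
Qed.

Lemma skew_motion A D :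
  nonneg_mx A -> D^T = - D ->
  (forall k l, A k l = 0 -> 0 <= (A *m D) k l) ->
  infinitesimal_motion A (A *m D).
Proof.
move=> A_ge0 skewD AD_ge0; split; last exact: nonneg_for_small_time.
move=> i j; rewrite !row_mul trmx_mul skewD mulNmx mulmxN !mulmxA.
by rewrite addNr.
Qed.

Lemma rigid_skew_eq0 A D :
  nonneg_rank_factor A -> infinitesimally_rigid A -> D^T = - D ->
  (forall k l, A k l = 0 -> 0 <= (A *m D) k l) -> D = 0.
Proof.
move=> [A_ge0 rankA] rigidA skewD AD_ge0.
have AD0 := rigidA _ (skew_motion A_ge0 skewD AD_ge0).
have /row_freeP[B trAB] : row_free A^T by rewrite /row_free mxrank_tr rankA.
have BA : B^T *m A = 1%:M by rewrite -[A]trmxK -trmx_mul trAB trmx1.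
by rewrite -[D]mul1mx -BA -mulmxA AD0 mulmx0.
Qed.

End SkewMotions.

(** The dichotomy behind the final [+ 1] of the zero count: a map to a space of
    at most the same dimension is either not injective or bijective, and in the
    second case the positive vector with all entries 1 is attained. *)
Lemma exists_nonneg_image (R : realFieldType) (m z : nat) (M : 'M[R]_(m, z)) :
  (0 < m)%N -> (z <= m)%N ->
  exists2 u : 'rV[R]_m, u != 0 & forall q, 0 <= (u *m M) 0 q.
Proof.
move=> m_gt0 le_zm; have [freeM|] := boolP (row_free M); last first.
  rewrite -kermx_eq0 => /rowV0Pn[u /sub_kermxP uM0 u_neq0].
  by exists u => // q; rewrite uM0 mxE.
have fullM : row_full M.
  by rewrite /row_full eqn_leq rank_leq_col (eqP freeM).
have z_gt0 : (0 < z)%N by rewrite -(eqP fullM) (eqP freeM).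
have [B BM] := row_fullP fullM.
have uM : const_mx 1 *m B *m M = const_mx 1 :> 'rV[R]_z.
  by rewrite -mulmxA BM mulmx1.
exists (const_mx 1 *m B) => [|q]; last by rewrite uM mxE.
apply/eqP => u0; move: uM; rewrite u0 mul0mx => /rowP/(_ (Ordinal z_gt0)).
by rewrite !mxE => /esym/eqP; rewrite oner_eq0.
Qed.

Section SkewBasis.

Variables (R : pzRingType) (r : nat).

Definition skew_delta (i j : 'I_r) : 'M[R]_r := delta_mx i j - delta_mx j i.

Lemma tr_skew_delta i j : (skew_delta i j)^T = - skew_delta i j.
Proof. by rewrite linearB /= !trmx_delta opprB. Qed.

Definition upper_pairs : {set 'I_r * 'I_r} :=
  [set p : 'I_r * 'I_r | (p.1 < p.2)%N].

Lemma card_upper_pairs : #|upper_pairs| = 'C(r, 2).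
Proof.
rewrite -bin2_sum -sum1_card big_mkord.
under eq_bigl => p do rewrite inE.
rewrite -(pair_big_dep xpredT (fun i j : 'I_r => i < j)%N (fun _ _ => 1%N)) /=.
rewrite (exchange_big_dep xpredT) //=; apply: eq_bigr => j _.
rewrite -(big_ord_widen r (fun _ => 1%N) (ltnW (ltn_ord j))).
by rewrite sum1_card card_ord.
Qed.

Definition skew_of (u : 'rV[R]_#|upper_pairs|) : 'M[R]_r :=
  \sum_s u 0 s *: skew_delta (enum_val s).1 (enum_val s).2.

Lemma tr_skew_of u : (skew_of u)^T = - skew_of u.
Proof.
rewrite /skew_of linear_sum /= -sumrN; apply: eq_bigr => s _.
by rewrite linearZ /= tr_skew_delta scalerN.
Qed.

(** This makes [skew_of] injective, so that the skew matrices have as many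
    independent parameters as there are upper pairs. *)
Lemma skew_of_upper u s : skew_of u (enum_val s).1 (enum_val s).2 = u 0 s.
Proof.
have upper (q : 'I_#|upper_pairs|) : ((enum_val q).1 < (enum_val q).2)%N.
  by have := enum_valP q; rewrite inE.
have lower_part (q : 'I_#|upper_pairs|) :
    ((enum_val s).1 == (enum_val q).2) && ((enum_val s).2 == (enum_val q).1)
      = false.
  apply/negP => /andP[/eqP s1 /eqP s2].
  have lt_q := upper q; rewrite -s1 -s2 in lt_q.
  by have := ltn_trans (upper s) lt_q; rewrite ltnn.
rewrite /skew_of summxE (bigD1 s) //= big1 => [|q neq_qs].
  by rewrite !mxE lower_part !eqxx subr0 mulr1 addr0.
rewrite !mxE lower_part subr0 -xpair_eqE -!surjective_pairing.
by rewrite (inj_eq enum_val_inj) eq_sym (negPf neq_qs) mulr0.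
Qed.

End SkewBasis.

Section Rigid.

Variables (R : realType) (n r : nat) (A : 'M[R]_(n, r)).
Hypotheses (factorA : nonneg_rank_factor A) (rigidA : infinitesimally_rigid A).

Lemma rigid_zero_entries : (1 < r)%N -> ('C(r, 2) < #|zero_entries A|)%N.
Proof.
move=> r_gt1; rewrite ltnNge -(card_upper_pairs r); apply/negP => few_zeros.
pose zero_forms : 'M[R]_(#|upper_pairs r|, #|zero_entries A|) :=
  \matrix_(s, q)
    (A *m skew_delta R (enum_val s).1 (enum_val s).2)
      (enum_val q).1 (enum_val q).2.
have pairs_gt0 : (0 < #|upper_pairs r|)%N by rewrite card_upper_pairs bin_gt0.
have [u u_neq0 u_ge0] := exists_nonneg_image zero_forms pairs_gt0 few_zeros.
suff skew0 : skew_of u = 0.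
  case/negP: u_neq0; apply/eqP/rowP => s.
  by rewrite -skew_of_upper skew0 !mxE.
apply: (rigid_skew_eq0 factorA rigidA (tr_skew_of u)) => k l Akl0.
have zero_kl : (k, l) \in zero_entries A by rewrite inE Akl0 eqxx.
have <- : (u *m zero_forms) 0 (enum_rank_in zero_kl (k, l))
            = (A *m skew_of u) k l; last exact: u_ge0.
rewrite [LHS]mxE mulmx_sumr summxE; apply: eq_bigr => s _.
by rewrite -scalemxAr [RHS]mxE [zero_forms _ _]mxE enum_rankK_in.
Qed.

(** The matrix [skew_delta i j] moves the [j]-th column of [A] along the
    [i]-th, which is nonnegative, and the [i]-th column against the [j]-th.
    Only the second velocity can be negative, and it is harmless when every
    zero of column [i] is also a zero of column [j]. *)
Lemma rigid_separating_row (i j : 'I_r) :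
  i != j -> exists k : 'I_n, A k i = 0 /\ A k j <> 0.
Proof.
move=> neq_ij.
have [/existsP[k /andP[/eqP Aki /eqP Akj]]|] :=
  boolP [exists k, (A k i == 0) && (A k j != 0)]; first by exists k.
move=> /existsPn no_row.
have zero_ij k : A k i = 0 -> A k j = 0.
  by move=> Aki; have := no_row k; rewrite Aki eqxx negbK => /eqP.
have col_delta k l (a b : 'I_r) :
    (A *m delta_mx a b) k l = A k a *+ (l == b).
  rewrite !mxE (bigD1 a) //= big1 => [|c neq_ca].
    by rewrite mxE eqxx /= addr0 mulr_natr.
  by rewrite mxE (negPf neq_ca) mulr0.
have /matrixP/(_ i j) : skew_delta R i j = 0.
  apply: (rigid_skew_eq0 factorA rigidA (tr_skew_delta R i j)) => k l Akl0.
  rewrite mulmxBr [_ k l]mxE [X in _ + X]mxE !col_delta.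
  have [l_i|_] := eqVneq l i; last by rewrite subr0 mulrn_wge0 // factorA.1.
  by rewrite zero_ij ?subr0 -?l_i // Akl0 mul0rn.
by rewrite !mxE !eqxx (negPf neq_ij) subr0 => /eqP; rewrite oner_eq0.
Qed.

End Rigid.

Theorem theorem6p3 (R : realType) (n r : nat) (n_gt0 : (0 < n)%N)
    (r_gt0 : (0 < r)%N) (A : 'M[R]_(n, r))
    (factorA : nonneg_rank_factor A) (rigidA : infinitesimally_rigid A) :
  ((1 < r)%N -> ((r ^ 2 - r) %/ 2 + 1 <= #|zero_entries A|)%N) /\
  (forall i j : 'I_r, i != j ->
     exists k : 'I_n, A k i = 0 /\ A k j <> 0).
Proof.
split; last by move=> i j; apply: rigid_separating_row.
move=> r_gt1; rewrite addn1 divn2 -mulnn -[X in (_ - X)%N]muln1 -mulnBr subn1.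
by rewrite -bin2; apply: rigid_zero_entries.
Qed.
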